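(* Let $S$ be a semigroup, and let $T$ be a subsemigroup of $S$ of finite Green index. Then the following are equivalent: (1) the semigroup $S$ satisfies $M_L$; (2) the semigroup $T$ satisfies $M_L$; (3) the $T$-biact ${}_TS_T$ satisfies $M_L$.
   Context: For a semigroup $S$, $S^1$ denotes the monoid obtained from $S$ by adjoining a new identity $1$, which acts as the identity on any biact. A $T$-biact is a set $A$ with a left action and a right action of the semigroup $T$ satisfying $t(t'a)=(tt')a$, $(at)t'=a(tt')$ and $(ta)t'=t(at')$. On a $T$-biact $A$ define preorders $a\leq_{\mathcal L}b\Leftrightarrow T^1a\subseteq T^1b$ and $a\leq_{\mathcal R}b\Leftrightarrow aT^1\subseteq bT^1$, with induced equivalence relations $\mathcal L$, $\mathcal R$, and let $\mathcal H=\mathcal L\cap\mathcal R$; $\leq_{\mathcal L}$ induces a partial order on the set of $\mathcal L$-classes. $A$ satisfies $M_L$ if every non-empty set of $\mathcal L$-classes of $A$ contains a minimal member. A semigroup $S$ satisfies $M_L$ if ${}_SS_S$ does, where ${}_SS_S$ is $S$ regarded as an $S$-biact via left and right multiplication. For a subsemigroup $T$ of $S$, ${}_TS_T$ denotes the set $S$ regarded as a $T$-biact via left and right multiplication in $S$. Each $\mathcal H$-class of ${}_TS_T$ lies entirely in $T$ or entirely in $S\setminus T$. The Green index of $T$ in $S$ is one more than the number of $\mathcal H$-classes of ${}_TS_T$ contained in $S\setminus T$. *)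

(* Defs.v *)
From HB Require Import structures.
From mathcomp Require Import all_boot.
From mathcomp Require Import boolp classical_sets functions cardinality.

Set Implicit Arguments.
Unset Strict Implicit.
Unset Printing Implicit Defensive.

Import Algebra.

Local Open Scope classical_set_scope.
Local Open Scope card_scope.
Local Open Scope group_scope.

(* Neither semigroups nor subsemigroups are required to be nonempty. Under
   the classical axioms of [boolp], every type has a [choiceType] structure
   and every subset is a boolean predicate, so [semigroupType] and
   [mulgClosed] cover all semigroups and all subsemigroups. *)
Definition subsemigroup (S : semigroupType) (T : mulgClosed S) : Type :=
  {x : S | x \in T}.

Section SubsemigroupInstances.
Variables (S : semigroupType) (T : mulgClosed S).

HB.instance Definition _ := SubChoice.on (subsemigroup T).

HB.instance Definition _ :=
  SubChoice_isSubSemigroup.Build S _ (subsemigroup T) (@gpredM S T).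

End SubsemigroupInstances.

Record biact (T : semigroupType) := Biact {
  biact_sort :> Type;
  lact : T -> biact_sort -> biact_sort;
  ract : biact_sort -> T -> biact_sort;
  lactA : forall t t' a, lact t (lact t' a) = lact (t * t') a;
  ractA : forall t t' a, ract (ract a t) t' = ract a (t * t');
  lractA : forall t t' a, ract (lact t a) t' = lact t (ract a t')
}.

Arguments Biact {T} biact_sort lact ract.

Definition regular_biact (S : semigroupType) : biact S.
Proof.
by refine (Biact S (fun t a => t * a) (fun a t => a * t) _ _ _)
  => t t' a; rewrite mulgA.
Defined.

Definition restricted_biact (S : semigroupType) (T : mulgClosed S) :
  biact (subsemigroup T).
Proof.
by refine (Biact S (fun t a => val t * a) (fun a t => a * val t) _ _ _)
  => t t' a; rewrite ?gmulfM mulgA.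
Defined.

Section Green.
Variables (T : semigroupType) (A : biact T).
Implicit Types (a b : A) (C D : set A).

(* The underlying set of the monoid T^1 is [option T], where [None] is the
   adjoined identity (adjoined even if T already has one). *)
Definition lact1 (t : option T) a : A := if t is Some u then lact u a else a.
Definition ract1 a (t : option T) : A := if t is Some u then ract a u else a.

Definition leL a b : Prop :=
  range (fun t => lact1 t a) `<=` range (fun t => lact1 t b).
Definition leR a b : Prop :=
  range (fun t => ract1 a t) `<=` range (fun t => ract1 b t).

Definition greenL a b : Prop := leL a b /\ leL b a.
Definition greenR a b : Prop := leR a b /\ leR b a.
Definition greenH a b : Prop := greenL a b /\ greenR a b.

Definition Lclass a : set A := [set b | greenL a b].
Definition Hclass a : set A := [set b | greenH a b].

Definition leLclass C D : Prop := exists a b, [/\ C a, D b & leL a b].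

Lemma leL_refl a : leL a a. Proof. by []. Qed.

Lemma leL_trans a b c : leL a b -> leL b c -> leL a c.
Proof. exact: subset_trans. Qed.

Lemma leLclassE a b : leLclass (Lclass a) (Lclass b) <-> leL a b.
Proof.
split=> [[c [d [[ac _] [_ db] cd]]]|ab].
  exact: leL_trans ac (leL_trans cd db).
by exists a, b; split=> //; split; exact: leL_refl.
Qed.

Lemma leLclass_anti a b : leLclass (Lclass a) (Lclass b) ->
  leLclass (Lclass b) (Lclass a) -> Lclass a = Lclass b.
Proof.
move=> /leLclassE ab /leLclassE ba; apply/seteqP; split=> c [h k]; split.
- exact: leL_trans ba h.
- exact: leL_trans k ab.
- exact: leL_trans ab h.
- exact: leL_trans k ba.
Qed.

Definition satisfies_ML : Prop :=
  forall X : set (set A), X `<=` range Lclass -> X !=set0 ->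
    exists2 C, X C & forall D, X D -> leLclass D C -> D = C.

End Green.

Definition semigroup_satisfies_ML (S : semigroupType) : Prop :=
  satisfies_ML (regular_biact S).

Definition outer_Hclasses (S : semigroupType) (T : mulgClosed S) :
    set (set S) :=
  [set C | range (@Hclass _ (restricted_biact T)) C /\
           forall x, C x -> x \notin T].

Definition is_green_index (S : semigroupType) (T : mulgClosed S) (n : nat) :
    Prop :=
  exists2 m, outer_Hclasses T #= `I_m & n = m.+1.

Definition finite_green_index (S : semigroupType) (T : mulgClosed S) : Prop :=
  exists n, is_green_index T n.

(* Main.v *)
Require Import Defs.
From HB Require Import structures.
From mathcomp Require Import all_boot.
From mathcomp Require Import boolp classical_sets functions cardinality.
Import Algebra.

(** If [u] and [v] are [L]-related over [T], then so are [u z] and [v z] for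
    every [z] in [S].  Hence a strictly [L]-descending chain cannot be written
    as [u_i z] with more multipliers [u_i] outside [T] than there are outer
    [H]-classes.  Over [S], the terms below some [x] are multiples [p_i x]; over
    [T], a chain lying in one [L]-class of [S] has its first [N] terms of the
    form [u_i z], with [z] the [N]-th term.  In both cases a multiplier in [T^1]
    contradicts minimality or strictness. *)

Local Open Scope classical_set_scope.
Local Open Scope card_scope.
Local Open Scope group_scope.

Section DescendingChains.
Context {T : semigroupType} {A : biact T}.
Implicit Types a b : A.

Lemma leLP a b : leL a b <-> exists t, lact1 t b = a.
Proof.
split=> [ab|[t <-] _ [u _ <-]].
  by have [|t _ tb] := ab a; [exists None | exists t].
(* The four cases are the multiplication table of the monoid [T^1]. *)
case: u t => [u|] [t|] /=; rewrite ?lactA.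
- by exists (Some (u * t)).
- by exists (Some u).
- by exists (Some t).
- by exists None.
Qed.

Definition strict_Lchain (f : nat -> A) : Prop :=
  forall n, leL (f n.+1) (f n) /\ ~ leL (f n) (f n.+1).

Lemma strict_Lchain_leL {f i j} : strict_Lchain f -> (i <= j)%N ->
  leL (f j) (f i).
Proof.
move=> fC; elim: j => [|j IHj]; first by rewrite leqn0 => /eqP ->.
rewrite leq_eqVlt => /orP[/eqP <- //|]; rewrite ltnS => /IHj fji.
exact: (@leL_trans _ _ _ _ _ (fC j).1 fji).
Qed.

Lemma strict_Lchain_NleL {f i j} : strict_Lchain f -> (i < j)%N ->
  ~ leL (f i) (f j).
Proof.
move=> fC ij fij; case: (fC i) => _; apply.
exact: (@leL_trans _ _ _ _ _ fij (strict_Lchain_leL fC ij)).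
Qed.

(** Here [f] need not be a chain, so that a chain for the preorder of one biact can be tested
    against [M_L] of the other. *)
Lemma ML_sequence (f : nat -> A) : satisfies_ML A ->
  exists n, forall m, leL (f m) (f n) -> leL (f n) (f m).
Proof.
move=> /(_ (range (fun n => Lclass (f n)))) ML.
have [_ [n _ <-]||_ [n _ <-] minn] := ML; first by exists (f n).
  by exists (Lclass (f 0)); exists 0.
exists n => m mn; apply/leLclassE; rewrite (minn (Lclass (f m))).
- exact/leLclassE.
- by exists m.
- exact/leLclassE.
Qed.

Lemma ML_no_strict_Lchain :
  satisfies_ML A <-> forall f : nat -> A, ~ strict_Lchain f.
Proof.
split=> [ML f fC|noC X XL [C0 XC0]].
  have [n minn] := ML_sequence f ML.
  by apply: (fC n).2; apply: minn; exact: (fC n).1.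
apply: contrapT => noMin.
(* Representatives replace classes, so that dependent choice can iterate the step to a strictly
   smaller element. *)
pose Y := {a : A | X (Lclass a)}.
have next (a : Y) : exists b : Y,
    leL (sval b) (sval a) /\ ~ leL (sval a) (sval b).
  apply: contrapT => noLess; apply: noMin.
  exists (Lclass (sval a)); first exact: (svalP a).
  move=> D XD; have [b _ bD] := XL D XD; rewrite -{D}bD in XD *.
  move=> ba; apply: (leLclass_anti ba); apply/leLclassE.
  apply: contrapT => nab; apply: noLess; exists (exist _ b XD).
  by split=> //; exact/leLclassE.
have [s sP] := choice next; have [a0 _ a0C] := XL C0 XC0.
have Xa0 : X (Lclass a0) by rewrite a0C.
apply: (noC (fun n => sval (iter n s (exist _ a0 Xa0)))) => n.
exact: sP.
Qed.

End DescendingChains.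

Section Subsemigroup.
Variables (S : semigroupType) (T : mulgClosed S).

Local Notation leLS := (@leL S (regular_biact S)).
Local Notation leLT := (@leL _ (restricted_biact T)).
Local Notation greenLT := (@greenL _ (restricted_biact T)).

Lemma leL_restrictedP (x y : S) :
  leLT x y <-> x = y \/ exists2 t, t \in T & x = t * y.
Proof.
split=> [/leLP[[t|] /= <-]|[->|[t tT ->]]].
- by right; exists (val t) => //; exact: valP.
- by left.
- by apply/leLP; exists None.
- by apply/leLP; exists (Some (exist (fun x => x \in T) t tT)).
Qed.

Lemma leL_regularP (x y : S) : leLS x y <-> x = y \/ exists t, x = t * y.
Proof.
split=> [/leLP[[t|] /= <-]|[->|[t ->]]].
- by right; exists t.
- by left.
- by apply/leLP; exists None.
- by apply/leLP; exists (Some t).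
Qed.

Lemma leL_val (x y : subsemigroup T) :
  @leL _ (regular_biact (subsemigroup T)) x y <-> leLT (val x) (val y).
Proof.
split=> /leLP[t txy]; apply/leLP; exists t; first by rewrite -txy; case: t txy.
apply: val_inj; rewrite -txy; by case: t txy.
Qed.

Lemma leL_restricted_regular {x y : S} : leLT x y -> leLS x y.
Proof.
move=> /leL_restrictedP[->|[t _ ->]]; apply/leL_regularP; first by left.
by right; exists t.
Qed.

Lemma leL_restricted_mul2r (z : S) {x y : S} : leLT x y -> leLT (x * z) (y * z).
Proof.
move=> /leL_restrictedP[->|[t tT ->]]; apply/leL_restrictedP; first by left.
by right; exists t; rewrite // mulgA.
Qed.

Lemma leL_regular_restricted {x y : S} : leLS x y ->
  leLT x y \/ exists2 t, t \notin T & x = t * y.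
Proof.
move=> /leL_regularP[->|[t ->]]; first by left; apply/leL_restrictedP; left.
have [tT|tNT] := boolP (t \in T); last by right; exists t.
by left; apply/leL_restrictedP; right; exists t.
Qed.

Lemma greenH_notin {x y : S} : @greenH _ (restricted_biact T) x y ->
  x \notin T -> y \notin T.
Proof.
move=> [[/leL_restrictedP[->//|[t tT ->]] _] _]; apply: contra => yT.
exact: gpredM.
Qed.

(** The bound [N] is the Green index, one more than the number of outer classes. Only the [L] half
    of the [H]-relation is kept, being what right multiplication by [S] preserves. *)
Lemma outer_pigeonhole : finite_green_index T -> exists N, forall g : nat -> S,
  (forall i, (i < N)%N -> g i \notin T) ->
  exists i j, (i < j < N)%N /\ greenLT (g i) (g j).
Proof.
move=> [_ [m Tm _]]; exists m.+1 => g gNT; apply: contrapT => noL.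
pose h i := @Hclass _ (restricted_biact T) (g i).
have hinj : {in `I_m.+1 &, injective h}.
  move=> i j; rewrite !inE /= => im jm hij.
  have gij : greenLT (g i) (g j).
    have : h j (g j) by do 2!split.
    by rewrite -hij => -[].
  case: (ltngtP i j) => // [ij|ji]; case: noL.
    by exists i, j; rewrite ij.
  by exists j, i; rewrite ji; split=> //; case: gij.
(* The [m.+1] distinct classes [h i] are all outer, and there are only [m] of those. *)
have : `I_m.+1 #<= `I_m.
  rewrite -(card_le_eql (inj_card_eq hinj)) -(card_le_eqr Tm).
  apply: subset_card_le => _ [i im <-]; split; first by exists (g i).
  by move=> x; move/greenH_notin; apply; exact: gNT.
by rewrite card_le_II ltnn.
Qed.

Lemma ML_restricted_sub :
  satisfies_ML (restricted_biact T) -> semigroup_satisfies_ML (subsemigroup T).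
Proof.
move=> /ML_no_strict_Lchain noC; apply/ML_no_strict_Lchain => f fC.
apply: (noC (fun n => val (f n))) => n; have [le nle] := fC n.
by split; [exact/leL_val | move/leL_val].
Qed.

(** By pigeonhole a strict chain cannot avoid [T]. Once inside it stays there, later terms being
    left [T^1]-multiples of earlier ones. *)
Lemma ML_sub_restricted : finite_green_index T ->
  semigroup_satisfies_ML (subsemigroup T) -> satisfies_ML (restricted_biact T).
Proof.
move=> /outer_pigeonhole[N pigeon] /ML_no_strict_Lchain noC.
apply/ML_no_strict_Lchain => f fC.
have [[n fnT]|fNT] := pselect (exists n, f n \in T); last first.
  have [i _|i [j [/andP[ij _] [fij _]]]] := pigeon f.
    by apply/negP => fiT; apply: fNT; exists i.
  exact: strict_Lchain_NleL fC ij fij.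
have fT k : f (n + k) \in T.
  have /leL_restrictedP[->//|[t tT ->]] :=
    strict_Lchain_leL fC (leq_addr k n).
  exact: gpredM.
apply: (noC (fun k => exist (fun x => x \in T) (f (n + k)) (fT k))) => k.
have [le nle] := fC (n + k); split; first by apply/leL_val; rewrite /= addnS.
by move/leL_val; rewrite /= addnS.
Qed.

Lemma ML_regular_restricted : finite_green_index T ->
  semigroup_satisfies_ML S -> satisfies_ML (restricted_biact T).
Proof.
move=> /outer_pigeonhole[N pigeon] MLS; apply/ML_no_strict_Lchain => f fC.
(* From index [n] on, all terms are [L]-related over [S], so an earlier term is a multiple of a
   later one. *)
have [n minn] := ML_sequence (f : nat -> regular_biact S) MLS.
have /choice[u uP] i : exists u, (i < N)%N ->
    u \notin T /\ f (n + i) = u * f (n + N).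
  (* The value [f 0] is a dummy for indices outside the range of the pigeonhole. *)
  have [iN|] := ltnP i N; last by exists (f 0).
  have le : leLS (f (n + i)) (f (n + N)).
    apply: (@leL_trans _ (regular_biact S) _ (f n)).
      exact: leL_restricted_regular (strict_Lchain_leL fC (leq_addr i n)).
    apply: minn.
    exact: leL_restricted_regular (strict_Lchain_leL fC (leq_addr N n)).
  case: (leL_regular_restricted le) => [leT|[u uT ->]]; last by exists u.
  by case: (strict_Lchain_NleL fC _ leT); rewrite ltn_add2l.
have [i /uP[]//|i [j [/andP[ij jN] [uij _]]]] := pigeon u.
have [[_ fi] [_ fj]] := (uP i (ltn_trans ij jN), uP j jN).
have := leL_restricted_mul2r (f (n + N)) uij; rewrite -fi -fj.
by apply: strict_Lchain_NleL => //; rewrite ltn_add2l.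
Qed.

Lemma ML_restricted_regular : finite_green_index T ->
  satisfies_ML (restricted_biact T) -> semigroup_satisfies_ML S.
Proof.
move=> /outer_pigeonhole[N pigeon] MLT; apply/ML_no_strict_Lchain => f fC.
have [n minn] := ML_sequence (f : nat -> restricted_biact T) MLT.
have /choice[p pP] k : exists p, p \notin T /\ f (n + k.+1) = p * f n.
  have le := strict_Lchain_leL fC (leq_addr k.+1 n).
  (* With a multiplier in [T^1], minimality over [T] would put [f n] below a later term, also over
     [S]. The shift to [k.+1] makes that term strictly later. *)
  case: (leL_regular_restricted le) => [/minn leT|[p pT ->]]; last by exists p.
  case: (strict_Lchain_NleL fC _ (leL_restricted_regular leT)).
  by rewrite addnS ltnS leq_addr.
have [i _|i [j [/andP[ij _] [pij _]]]] := pigeon p; first by case: (pP i).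
have := leL_restricted_mul2r (f n) pij.
(* The relation over [T] is weakened to one over [S], where the chain is strict. *)
rewrite -(pP i).2 -(pP j).2 => /leL_restricted_regular.
by apply: strict_Lchain_NleL => //; rewrite ltn_add2l ltnS.
Qed.

End Subsemigroup.

Theorem corollary4p7 (S : semigroupType) (T : mulgClosed S)
  (finT : finite_green_index T) :
  [<-> semigroup_satisfies_ML S;
       semigroup_satisfies_ML (subsemigroup T);
       satisfies_ML (restricted_biact T)].
Proof.
tfae.
- by move=> /(ML_regular_restricted _ _ finT); exact: ML_restricted_sub.
- exact: ML_sub_restricted.
- exact: ML_restricted_regular.
Qed.
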